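(* For $n\ge0$ and $k\in\mathbb Z$, $S_{n,k}(x)=A^\star_{n,k}(x+1)$, where for $k<n$ this holds for $|x|<1$ (as convergent power series); for $k\ge n$, $S_{n,k}$ is a polynomial. For all $n,k\ge\ell\ge0$, $$[x^\ell]\,S_{n,k}(x)=\frac{1}{\ell!}\frac{d^\ell}{dx^\ell}A^\star_{n,k}(x)\Big|_{x=1}=\sum_{\nu=0}^{\ell}\binom{k-n}{\ell-\nu}s_{n,\nu}.$$ If (R) holds and $k\ge n\ge0$, then $S_{n,k}$ is quasi-palindromic: $S_{n,k}(x)=(-1)^nx^kS_{n,k}(x^{-1})$. If moreover $n$ is odd and $k$ is even, then $[x^{k/2}]\,S_{n,k}(x)=0$.
   Context: Let $(\alpha_n)_{n\ge0}$ be an arbitrary sequence of complex numbers; its Appell polynomials are $A_n(x)=\sum_{\nu=0}^{n}\binom{n}{\nu}\alpha_{n-\nu}x^\nu$. For $n\ge0,k\in\mathbb Z$ let $A^\star_{n,k}(x)=x^kA_n(x^{-1})$. Let $s_{n,k}=\sum_{\nu=k}^{n}\binom{n}{\nu}\binom{\nu}{k}\alpha_\nu$ ($0\le k\le n$), $S_n(x)=\sum_{k=0}^n s_{n,k}x^k$, and define the formal power series $S_{n,k}(x)=S_n(x)(x+1)^{k-n}=S_n(x)\sum_{\nu\ge0}\binom{k-n}{\nu}x^\nu$ for $n\ge0$, $k\in\mathbb Z$ (generalized binomial coefficients). $[x^\ell]f(x)$ denotes the coefficient of $x^\ell$. Property (R) means $A_n(1-x)=(-1)^nA_n(x)$ for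 all $n\ge0$. *)

(* Defs.v *)
From HB Require Import structures.
From mathcomp Require Import all_boot all_order all_algebra.
From mathcomp Require Import complex.
From mathcomp Require Import all_classical all_reals all_analysis.
Set Implicit Arguments. Unset Strict Implicit. Unset Printing Implicit Defensive.
Import Order.TTheory GRing.Theory Num.Theory ComplexField.
Import numFieldNormedType.Exports.
Local Open Scope ring_scope.

Section Appell.
Variable (R : realType).
Local Notation C := R[i].
Variable (alpha : nat -> C).

Definition appell (n : nat) : {poly C} :=
  \sum_(nu < n.+1) ('C(n, nu)%:R * alpha (n - nu)) *: 'X^nu.

Definition Astar (n : nat) (k : int) (x : C) : C := x ^ k * (appell n).[x^-1].

Definition s_coef (n k : nat) : C :=
  \sum_(k <= nu < n.+1) 'C(n, nu)%:R * 'C(nu, k)%:R * alpha nu.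

(* Formal power series are coefficient sequences nat -> C. *)
Definition S_fps (n : nat) : nat -> C := fun k => if (k <= n)%N then s_coef n k else 0.

Definition fps_mul (f g : nat -> C) : nat -> C :=
  fun l => \sum_(i < l.+1) f i * g (l - i)%N.

End Appell.

Definition gbinom (F : fieldType) (a : int) (j : nat) : F :=
  (\prod_(i < j) (a%:~R - i%:R)) / (j`!)%:R.

Definition binom_fps (F : fieldType) (a : int) : nat -> F := fun nu => gbinom F a nu.

Definition Snk (R : realType) (alpha : nat -> R[i]) (n : nat) (k : int) : nat -> R[i] :=
  fps_mul (S_fps alpha n) (binom_fps R[i] (k - n%:Z)).

Definition propR (R : realType) (alpha : nat -> R[i]) : Prop :=
  forall (n : nat) (x : R[i]), (appell alpha n).[1 - x] = (-1) ^+ n * (appell alpha n).[x].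

(* Main.v *)
Require Import Defs.
From HB Require Import structures.
From mathcomp Require Import all_boot all_order all_algebra.
From mathcomp Require Import complex.
From mathcomp Require Import all_classical all_reals all_analysis.
From mathcomp Require Import ring.
Import Order.TTheory GRing.Theory Num.Theory ComplexField.
Import numFieldNormedType.Exports.
Local Open Scope classical_set_scope.
Local Open Scope ring_scope.

(** Exchanging sums and applying Vandermonde's identity gives, with
    c_i = 'C(n, i) alpha_i,
      [x^l] S_{n,k} = \sum_i c_i binom(k - n + i, l),
    while A*_{n,k}(x) = \sum_i c_i x^(k - n + i) for x != 0. Everything is thus a
    finite combination of the binomial series (1 + x)^a with a an integer, whose
    convergence on |x| < 1 follows by induction on a in both directions from
    Pascal's rule. Under (R), evaluating S_{n,k} at x and 1/x and using
    1 - 1/(x + 1) = x/(x + 1) gives the palindromic symmetry. *)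

(** * Generalized binomial coefficients: Pascal's rule and Vandermonde's identity *)

Lemma gbinom0 (F : numFieldType) a : gbinom F a 0 = 1.
Proof. by rewrite /gbinom big_ord0 fact0 divr1. Qed.

Lemma gbinomSr (F : numFieldType) a j :
  gbinom F a j.+1 = gbinom F a j * (a%:~R - j%:R) / j.+1%:R.
Proof.
rewrite /gbinom big_ord_recr /= factS natrM invfM.
by field; rewrite nat1r !pnatr_eq0 -?lt0n fact_gt0.
Qed.

(** All three terms are multiples of [gbinom F a j]: removing the first factor a + 1 from the
    product for a + 1 leaves the j factors of the product for a. *)
Lemma gbinomDr1 (F : numFieldType) a j :
  gbinom F (a + 1) j.+1 = gbinom F a j.+1 + gbinom F a j.
Proof.
have -> : gbinom F (a + 1) j.+1 = gbinom F a j * (a%:~R + 1) / j.+1%:R.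
  rewrite /gbinom big_ord_recl /= subr0 rmorphD /= factS natrM invfM.
  under eq_bigr => i _ do rewrite /bump /= natrD opprD addrA addrK.
  by field; rewrite nat1r !pnatr_eq0 -?lt0n fact_gt0.
rewrite gbinomSr; field.
by rewrite nat1r pnatr_eq0.
Qed.

Lemma gbinom_nat (F : numFieldType) (n j : nat) : gbinom F n j = 'C(n, j)%:R.
Proof.
elim: n j => [|n IHn] [|j]; rewrite ?gbinom0 ?bin0 //.
  by rewrite /gbinom big_ord_recl /= subrr !mul0r.
by rewrite -addn1 PoszD gbinomDr1 !IHn addn1 binS natrD.
Qed.

Lemma gbinom_Vandermonde (F : numFieldType) (m l : nat) (a : int) :
  \sum_(i < l.+1) 'C(m, i)%:R * gbinom F a (l - i) = gbinom F (a + m%:Z) l.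
Proof.
elim: m l => [|m IHm] l.
  rewrite big_ord_recl big1 => [|i _]; first by rewrite mul1r subn0 !addr0.
  by rewrite bin0n mul0r.
case: l => [|l]; first by rewrite big_ord1 !bin0 !gbinom0 mul1r.
rewrite -[m.+1]addn1 PoszD addrA gbinomDr1 -!IHm addn1.
rewrite big_ord_recl [in RHS]big_ord_recl -addrA; congr (_ + _).
  by rewrite !bin0.
rewrite -big_split; apply: eq_bigr => i _ /=.
by rewrite /bump /= add1n subSS binS natrD mulrDl.
Qed.

(** * Derivatives of finite sums of integer powers *)

Lemma is_derive_exprz (K : numFieldType) (a : int) (x : K) : x != 0 ->
  is_derive (x : K^o) (1 : K^o) (fun z : K^o => z ^ a : K^o)
    (a%:~R * x ^ (a - 1)).
Proof.
move=> x0.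
have DX (n : nat) : is_derive (x : K^o) (1 : K^o)
    (fun z : K^o => z ^+ n : K^o) (n%:R * x ^+ n.-1).
  have -> : (fun z : K^o => z ^+ n : K^o) = (id : K^o -> K^o) ^+ n.
    by apply/funext => z; rewrite fctE.
  by apply: is_derive_eq; rewrite /GRing.scale /= mulr1.
case: a => n.
  suff -> : (Posz n)%:~R * x ^ (Posz n - 1) = n%:R * x ^+ n.-1 by exact: DX.
  by case: n => [|n]; rewrite ?mul0r // (_ : n.+1%:Z - 1 = n)// -addn1 PoszD addrK.
have xn0 : x ^+ n.+1 != 0 by rewrite expf_neq0.
have [dX DXE] := DX n.+1.
apply: DeriveDef; first exact: derivableV.
rewrite deriveV// DXE /GRing.scale /=.
have -> : Negz n - 1 = Negz n.+1 by rewrite !NegzE [n.+2%:Z]intS opprD addrC.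
rewrite !NegzE rmorphN /= -!exprnN !exprS.
by field; rewrite x0 expf_neq0.
Qed.

(** Differentiation is local, so a formula for [f] away from 0 suffices: a neighbourhood of [x]
    avoids 0. *)
Lemma derive1_sum_exprz (K : numFieldType) n (c : 'I_n -> K) (e : 'I_n -> int)
    (f : K^o -> K^o) (x : K) :
    (forall y, y != 0 -> f y = \sum_(i < n) c i * y ^ e i) -> x != 0 ->
  derive1 f x = \sum_(i < n) c i * (e i)%:~R * x ^ (e i - 1).
Proof.
move=> fE x0; rewrite derive1E.
rewrite (@near_eq_derive _ _ _ _ (\sum_(i < n) (c i *: (fun z : K^o => z ^ e i : K^o)))).
  have D i := is_derive_exprz _ (e i) _ x0.
  rewrite derive_val; apply: eq_bigr => i _.
  by rewrite /GRing.scale /= mulrA.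
have xx : z @[z --> (x : K^o)] --> (x : K^o) by exact: cvg_id.
by apply: filterS (cvgr_neq0 _ xx x0) => y y0; rewrite fE// fct_sumE.
Qed.

(** Each derivative is again a sum of powers valid off 0, so the previous lemma iterates; l!
    binom(e, l) is the falling factorial of e. *)
Lemma derive1n_sum_exprz (K : numFieldType) n (c : 'I_n -> K) (e : 'I_n -> int)
    (f : K^o -> K^o) (l : nat) (x : K) :
    (forall y, y != 0 -> f y = \sum_(i < n) c i * y ^ e i) -> x != 0 ->
  derive1n l f x =
    \sum_(i < n) c i * (l`!%:R * gbinom K (e i) l) * x ^ (e i - l%:Z).
Proof.
move=> fE; elim: l x => [|l IHl] x x0.
  rewrite derive1n0 fE//; apply: eq_bigr => i _.
  by rewrite gbinom0 !mulr1 subr0.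
rewrite derive1nS (derive1_sum_exprz _ _ _ _ _ _ IHl)//; apply: eq_bigr => i _.
rewrite -addrA -opprD -PoszD addn1 gbinomSr factS natrM rmorphB /=.
by field; rewrite nat1r pnatr_eq0.
Qed.

(** * Convergence of the binomial series with integer exponent *)

Lemma cvg_exprC (R : realType) (r : R[i]) : 0 <= r < 1 ->
  (fun j => r ^+ j : R[i]^o) @ \oo --> (0 : R[i]^o).
Proof.
(* Being comparable to 0, [r] and the tolerance [e] are real; both are replaced by their real parts
   to reach the real geometric sequence. *)
move=> /andP[r0 r1].
have rE := RRe_real (ger0_real r0).
move: (complex.Re r) rE => s rE.
have s0 : 0 <= s by rewrite -ler0c rE.
have s1 : s < 1 by rewrite -ltcR rE.
apply/cvgr0Pnorm_le => e e0.
have eE := RRe_real (gtr0_real e0).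
have : (0 < complex.Re e) by rewrite -ltcR eE.
move: (complex.Re e) eE => d eE d0.
have /cvg_expr/cvgr0Pnorm_le/(_ _ d0) : `|s| < 1 by rewrite ger0_norm.
apply: filterS => j /=.
rewrite -eE -lecR -rE (ger0_norm (exprn_ge0 j s0)) ger0_norm.
  by rewrite rmorphXn.
by rewrite exprn_ge0// ler0c.
Qed.

Lemma cvg0_contraction (R : realType) (a : R[i]) (u v : nat -> R[i]^o) :
    `|a| < 1 -> (forall n, u n.+1 = a * u n + v n) ->
  v @ \oo --> (0 : R[i]^o) -> u @ \oo --> (0 : R[i]^o).
Proof.
move=> a1 uE /cvgr0Pnorm_le v0.
have a1' : 0 < 1 - `|a| by rewrite subr_gt0.
apply/cvgr0Pnorm_le => e e0.
have e2 : 0 < e / 2 by rewrite divr_gt0.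
(* With this tolerance, e / 2 is the fixed point of t |-> |a| t + (e / 2)(1 - |a|), so the recursion
   only shrinks the initial term. *)
have [N _ vN] := v0 _ (mulr_gt0 e2 a1').
have uN j : `|u (N + j)%N| <= `|a| ^+ j * `|u N| + e / 2.
  elim: j => [|j IHj]; first by rewrite addn0 expr0 mul1r lerDl ltW.
  rewrite addnS uE (le_trans (ler_normD _ _))//.
  have -> : `|a| ^+ j.+1 * `|u N| + e / 2 =
     `|a| * (`|a| ^+ j * `|u N| + e / 2) + e / 2 * (1 - `|a|) by rewrite exprS; ring.
  by rewrite lerD ?normrM ?ler_wpM2l// vN//= leq_addr.
have : (fun j => `|a| ^+ j * `|u N| : R[i]^o) @ \oo --> (0 : R[i]^o).
  rewrite -[0](mul0r `|u N|); apply: cvgM; last exact: cvg_cst.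
  by apply: cvg_exprC; rewrite normr_ge0.
move=> /cvgr0Pnorm_le /(_ _ e2)[M _ aM].
exists (N + M)%N => // m /= NMm.
rewrite -(subnKC (leq_trans (leq_addr M N) NMm)) (le_trans (uN _))//.
rewrite [leRHS]splitr lerD2r -[leLHS]ger0_norm ?mulr_ge0 ?exprn_ge0//.
by apply: aM; rewrite /= leq_subRL// (leq_trans (leq_addr M N) NMm).
Qed.

(** Pascal's rule summed over l: the truncated form of (1 + x)^(a + 1) = (1 + x) (1 + x)^a. *)
Lemma gbinom_seriesD1 (K : numFieldType) (a : int) (x : K) (N : nat) :
  let P b := series (fun l => (gbinom K b l * x ^+ l : K^o)) in
  P (a + 1) N.+1 = P a N.+1 + x * P a N.
Proof.
rewrite /= !seriesEord /= big_ord_recl [in RHS]big_ord_recl !gbinom0 -addrA.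
congr (_ + _); rewrite mulr_sumr -big_split; apply: eq_bigr => i _ /=.
by rewrite /bump /= add1n gbinomDr1 exprS; ring.
Qed.

Lemma addr1_neq0 (K : numDomainType) (x : K) : `|x| < 1 -> x + 1 != 0.
Proof.
by apply: contraTneq => /eqP; rewrite addr_eq0 => /eqP ->; rewrite normrN1 ltxx.
Qed.

Lemma cvg_gbinom_series (R : realType) (a : int) (x : R[i]) : `|x| < 1 ->
  series (fun l => (gbinom R[i] a l * x ^+ l : R[i]^o)) @ \oo -->
    ((x + 1) ^ a : R[i]^o).
Proof.
move=> x1.
have x10 := addr1_neq0 _ _ x1.
pose P b := series (fun l => (gbinom R[i] b l * x ^+ l : R[i]^o)).
have P0 : P 0 @ \oo --> (1 : R[i]^o).
  (* Only the term l = 0 survives, so every partial sum but the empty one is 1. *)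
  rewrite -cvg_shiftS (_ : (fun n => P 0 n.+1) = fun=> 1); first exact: cvg_cst.
  apply/funext => N; rewrite /P seriesEord /= big_ord_recl big1 => [|i _].
    by rewrite gbinom0 mulr1 addr0.
  by rewrite gbinom_nat bin0n mul0r.
have PS b N : P (b + 1) N.+1 = P b N.+1 + x * P b N := gbinom_seriesD1 _ b x N.
(* Keeping the body of P makes unification diverge below. *)
rewrite -/(P a); clearbody P.
have powS b : (x + 1) ^ (b + 1) = (x + 1) ^ b + x * (x + 1) ^ b.
  by rewrite expfzDr// expr1z; ring.
have Pup b : P b @ \oo --> ((x + 1) ^ b : R[i]^o) ->
    P (b + 1) @ \oo --> ((x + 1) ^ (b + 1) : R[i]^o).
  move=> Pb; rewrite -cvg_shiftS powS.
  rewrite (_ : (fun n => P (b + 1) n.+1) = fun N => P b N.+1 + x * P b N).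
    by apply: cvgD; [rewrite cvg_shiftS | apply: cvgMr].
  by apply/funext => N; exact: PS.
have Pdown b : P (b + 1) @ \oo --> ((x + 1) ^ (b + 1) : R[i]^o) ->
    P b @ \oo --> ((x + 1) ^ b : R[i]^o).
  move=> Pb.
  have v0 : (fun N => P (b + 1) N.+1 - (x + 1) ^ (b + 1) : R[i]^o) @ \oo --> (0 : R[i]^o).
    by apply/subr_cvg0; rewrite cvg_shiftS.
  (* The error for b satisfies a recursion with ratio -x, driven by the error for b + 1, which tends
     to 0. *)
  have rec N : P b N.+1 - (x + 1) ^ b = - x * (P b N - (x + 1) ^ b) +
      (P (b + 1) N.+1 - (x + 1) ^ (b + 1)).
    by rewrite powS PS; ring.
  have Nx1 : `|- x| < 1 by rewrite normrN.
  have u0 := @cvg0_contraction R (- x) (fun N => P b N - (x + 1) ^ b) _ Nx1 rec v0.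
  exact: (subr_cvg0 _ _).1 u0.
elim: a => [|n IHn|n IHn].
- by rewrite expr0z.
- by rewrite -addn1 PoszD; exact: Pup.
- by apply: Pdown; rewrite intS opprD addrAC addNr add0r.
Qed.

(** * Polynomial identities by evaluation, and reversal of coefficients *)

Lemma coef_XD1_exp (F : nzRingType) (n l : nat) :
  (('X + 1 : {poly F}) ^+ n)`_l = 'C(n, l)%:R.
Proof.
rewrite exprD1n.
under eq_bigr do rewrite -scaler_nat.
rewrite -(poly_def n.+1 (fun i => 'C(n, i)%:R)) coef_poly.
by case: ltnP => // nl; rewrite bin_small.
Qed.

(** A nonzero p - q would have as roots 1, ..., size (p - q), more than its degree. These points
    avoid 0 and -1, where the reciprocity formula breaks down. *)
Lemma poly_eq_posnat (F : numDomainType) (p q : {poly F}) :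
  (forall m, p.[m.+1%:R] = q.[m.+1%:R]) -> p = q.
Proof.
move=> pq; apply/eqP; rewrite -subr_eq0; apply/negPn/negP => pq0.
have := @max_poly_roots _ _ [seq i.+1%:R | i <- iota 0 (size (p - q))] pq0.
rewrite size_map size_iota ltnn => max_roots.
suff: false by [].
apply: max_roots.
  apply/allP => _ /mapP[i _ ->].
  by rewrite /root hornerD hornerN pq subrr.
by rewrite map_inj_uniq ?iota_uniq// => i j /eqP; rewrite eqr_nat => /eqP[].
Qed.

Lemma horner_rev_poly (F : fieldType) (p : {poly F}) (k : nat) (x : F) :
  (size p <= k.+1)%N -> x != 0 ->
  (\poly_(i < k.+1) p`_(k - i)).[x] = x ^+ k * p.[x^-1].
Proof.
move=> pk x0; rewrite horner_poly (horner_coef_wide _ pk) mulr_sumr.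
rewrite (reindex_inj rev_ord_inj); apply: eq_bigr => i _ /=.
have ik : (i <= k)%N by rewrite -ltnS.
by rewrite subSS subKn// mulrCA exprVn expfB_cond// (negPf x0).
Qed.

(** * The series S_{n,k} and the functions A*_{n,k} *)

Section Appell.
Variables (R : realType) (alpha : nat -> R[i]).
Implicit Types (n l : nat) (k : int) (x : R[i]).

Lemma s_coefE n l : s_coef alpha n l =
  \sum_(i < n.+1) 'C(n, i)%:R * alpha i * 'C(i, l)%:R.
Proof.
rewrite /s_coef big_geq_mkord big_mkcond /=; apply: eq_bigr => i _.
by case: leqP => [_|/bin_small ->]; rewrite ?mulr0// mulrAC.
Qed.

(** The cut-off value 0 above n agrees with the empty sum in [s_coef]. *)
Lemma S_fpsE n : S_fps alpha n = s_coef alpha n.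
Proof.
apply/funext => l; rewrite /S_fps; case: leqP => // nl.
by rewrite /s_coef big_geq.
Qed.

Lemma Snk_gbinom n k l : Snk alpha n k l =
  \sum_(i < n.+1) 'C(n, i)%:R * alpha i * gbinom R[i] (k - n%:Z + i%:Z) l.
Proof.
rewrite /Snk /fps_mul S_fpsE.
under eq_bigr do rewrite s_coefE mulr_suml.
rewrite exchange_big; apply: eq_bigr => i _ /=.
rewrite -gbinom_Vandermonde mulr_sumr.
by apply: eq_bigr => j _; rewrite /binom_fps !mulrA.
Qed.

Lemma Astar_exprz n k x : x != 0 -> Astar alpha n k x =
  \sum_(i < n.+1) 'C(n, i)%:R * alpha i * x ^ (k - n%:Z + i%:Z).
Proof.
move=> x0; rewrite /Astar /appell horner_sum mulr_sumr.
rewrite (reindex_inj rev_ord_inj); apply: eq_bigr => i _ /=.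
have ni : (i <= n)%N by rewrite -ltnS.
rewrite subSS bin_sub// subKn// hornerZ hornerXn mulrCA; congr (_ * _).
by rewrite exprVn exprnN -expfzDr// -subzn// opprB addrA addrAC.
Qed.

Lemma cvg_Snk n k x : `|x| < 1 ->
  series (fun l => (Snk alpha n k l * x ^+ l : R[i]^o)) @ \oo -->
    (Astar alpha n k (x + 1) : R[i]^o).
Proof.
move=> x1.
have x10 := addr1_neq0 _ _ x1.
rewrite Astar_exprz//.
pose P b := series (fun l => (gbinom R[i] b l * x ^+ l : R[i]^o)).
rewrite (_ : series _ = fun N =>
    \sum_(i < n.+1) 'C(n, i)%:R * alpha i * P (k - n%:Z + i%:Z) N).
  apply: cvg_big => [|i _]; first exact: add_continuous.
  by apply: cvgMr; exact: cvg_gbinom_series.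
apply/funext => N; rewrite seriesEord /=.
under eq_bigr do rewrite Snk_gbinom mulr_suml.
rewrite exchange_big; apply: eq_bigr => i _ /=.
rewrite /P seriesEord /= mulr_sumr; apply: eq_bigr => l _.
exact/esym/mulrA.
Qed.

(** The exponents k - n + i are now natural numbers, so each binomial series is the polynomial ('X +
    1)^(k - n + i). *)
Lemma Snk_poly n (k : nat) : (n <= k)%N -> exists p : {poly R[i]},
  (forall l, Snk alpha n k%:Z l = p`_l) /\
  (forall x, x + 1 != 0 -> p.[x] = Astar alpha n k%:Z (x + 1)).
Proof.
move=> nk.
exists (\sum_(i < n.+1) ('C(n, i)%:R * alpha i) *: ('X + 1) ^+ (k - n + i)).
split=> [l|x x0].
  rewrite Snk_gbinom coef_sum; apply: eq_bigr => i _.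
  by rewrite subzn// -PoszD gbinom_nat coefZ coef_XD1_exp.
rewrite Astar_exprz// horner_sum; apply: eq_bigr => i _.
by rewrite hornerZ horner_exp hornerD hornerX hornerC subzn.
Qed.

Lemma Snk_derive n k l : Snk alpha n k l =
  (l`!%:R)^-1 * derive1n l (Astar alpha n k : R[i]^o -> R[i]^o) 1.
Proof.
rewrite (derive1n_sum_exprz _ _ _ _ _ l _ (Astar_exprz n k)) ?oner_eq0//.
rewrite Snk_gbinom mulr_sumr; apply: eq_bigr => i _.
by rewrite exp1rz; field; rewrite pnatr_eq0 -lt0n fact_gt0.
Qed.

(** The exponents k - n + i are at most k because i <= n. *)
Lemma Snk_poly_size n (k : nat) (p : {poly R[i]}) : (n <= k)%N ->
  (forall l, Snk alpha n k%:Z l = p`_l) -> (size p <= k.+1)%N.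
Proof.
move=> nk pE; apply/leq_sizeP => l kl; rewrite -pE Snk_gbinom big1// => i _.
rewrite subzn// -PoszD gbinom_nat (@bin_small (_ + _)) ?mulr0//.
by apply: leq_ltn_trans kl; rewrite -[leqRHS](subnK nk) leq_add2l -ltnS.
Qed.

Lemma Astar_recip n (k : nat) x : propR alpha -> x != 0 -> x + 1 != 0 ->
  Astar alpha n k%:Z (x + 1) = (-1) ^+ n * x ^+ k * Astar alpha n k%:Z (x^-1 + 1).
Proof.
move=> alphaR x0 x1.
have -> : x^-1 + 1 = (x + 1) / x by field.
have yE : ((x + 1) / x)^-1 = 1 - (x + 1)^-1 by field; rewrite x0 x1.
rewrite /Astar yE alphaR -!exprnP expr_div_n.
have s2 : (-1) ^+ n * (-1) ^+ n = 1 :> R[i] by rewrite -expr2 sqrr_sign.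
have xk0 : x ^+ k != 0 by rewrite expf_neq0.
(* (R) puts a second sign on the right; inserting (-1)^n squared on the left balances it, so that
   the sign can be generalized before [field]. *)
rewrite -[LHS]mul1r -[X in X * _ = _]s2; move: xk0 {s2}.
move: (x ^+ k) ((x + 1) ^+ k) ((-1) ^+ n) => a b s a0.
by field.
Qed.

Lemma Snk_poly_recip n (k : nat) (p : {poly R[i]}) : propR alpha -> (n <= k)%N ->
  (forall l, Snk alpha n k%:Z l = p`_l) ->
  p = (-1) ^+ n *: \poly_(i < k.+1) p`_(k - i).
Proof.
move=> alphaR nk pE; apply: poly_eq_posnat => m.
have [q [qE qA]] := Snk_poly _ _ nk.
have {qE} pq : q = p by apply/polyP => l; rewrite -pE qE.
have x0 : m.+1%:R != 0 :> R[i] by rewrite pnatr_eq0.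
have x1 : m.+1%:R + 1 != 0 :> R[i] by rewrite natr1 pnatr_eq0.
have y1 : m.+1%:R^-1 + 1 != 0 :> R[i] by rewrite gt_eqF// addr_gt0// invr_gt0.
rewrite hornerZ horner_rev_poly// ?(Snk_poly_size _ _ _ nk pE)//.
by rewrite mulrA -pq !qA// Astar_recip.
Qed.

End Appell.

Theorem mainTheorem6 (R : realType) (alpha : nat -> R[i]) :
  (* S_{n,k}(x) = A*_{n,k}(x+1) for k < n, as convergent power series on |x| < 1 *)
  (forall (n : nat) (k : int), k < n%:Z -> forall x : R[i], `|x| < 1 ->
     series (fun l => (Snk alpha n k l * x ^+ l : R[i]^o)) @ \oo --> (Astar alpha n k (x + 1) : R[i]^o))
  /\
  (* for k >= n, S_{n,k} is a polynomial, and S_{n,k}(x) = A*_{n,k}(x+1) *)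
  (forall (n k : nat), (n <= k)%N ->
     exists p : {poly R[i]}, (forall l, Snk alpha n k%:Z l = p`_l) /\
       (forall x : R[i], x + 1 != 0 -> p.[x] = Astar alpha n k%:Z (x + 1)))
  /\
  (* coefficient formulas for n, k >= l >= 0 *)
  (forall (n k l : nat), (l <= n)%N -> (l <= k)%N ->
     Snk alpha n k%:Z l = (l`!%:R)^-1 * derive1n l (Astar alpha n k%:Z : R[i]^o -> R[i]^o) 1
     /\ Snk alpha n k%:Z l
        = \sum_(nu < l.+1) gbinom R[i] (k%:Z - n%:Z) (l - nu) * s_coef alpha n nu)
  /\
  (* under (R): quasi-palindromicity for k >= n, and vanishing middle coefficient *)
  (propR alpha ->
     forall (n k : nat), (n <= k)%N ->
       (forall p : {poly R[i]}, (forall l, Snk alpha n k%:Z l = p`_l) ->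
          forall x : R[i], x != 0 -> p.[x] = (-1) ^+ n * x ^+ k * p.[x^-1])
       /\ (odd n -> ~~ odd k -> Snk alpha n k%:Z k./2 = 0)).
Proof.
split; first by move=> n k _ x; exact: cvg_Snk.
split; first by move=> n k; exact: Snk_poly.
split=> [n k l _ _|alphaR n k nk].
  split; first exact: Snk_derive.
  by rewrite /Snk /fps_mul S_fpsE; apply: eq_bigr => i _; rewrite mulrC.
split=> [p pE x x0|n_odd k_even].
  rewrite {1}(Snk_poly_recip _ _ _ _ _ alphaR nk pE) hornerZ -mulrA.
  by rewrite horner_rev_poly// (Snk_poly_size _ _ _ _ _ nk pE).
have [p [pE _]] := Snk_poly _ alpha _ _ nk.
have kE : (k - k./2 = k./2)%N.
  by rewrite -[X in (X - _)%N](even_halfK k_even) -addnn addnK.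
have k2 : (k./2 <= k)%N by rewrite -[leqRHS]half_double half_leq// -addnn leq_addr.
(* For even k, reversal fixes the middle coefficient c; with n odd this reads c = -c, hence 2c =
   0. *)
have := congr1 (fun q : {poly R[i]} => q`_k./2) (Snk_poly_recip _ _ _ _ _ alphaR nk pE).
rewrite coefZ coef_poly ltnS k2 kE -signr_odd n_odd expr1 mulN1r.
by rewrite pE => /eqP; rewrite -addr_eq0 -mulr2n mulrn_eq0 => /eqP.
Qed.
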